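(* For an integer $N\geq 2$, let $\ell_N$ denote the length of the longest run of consecutive positive integers, all smaller than $N$, which all have the same number of positive divisors. Then there exist constants $C>0$ and $N_0$ such that for all $N\geq N_0$, \[\log \ell_N \leq C\sqrt{\log N\cdot\log\log N}.\]
   Context: A run of consecutive integers means a set $\{n+1,n+2,\ldots,n+k\}$ of positive integers; it has the property in question if $d(n+1)=d(n+2)=\cdots=d(n+k)$, where $d(m)$ denotes the number of positive divisors of $m$. $\log$ is the natural logarithm. *)

(* Defs.v *)
From mathcomp Require Import all_boot.

Set Implicit Arguments.
Unset Strict Implicit.
Unset Printing Implicit Defensive.

Definition ndiv (m : nat) : nat := size (divisors m).

(* The run is {n+1, ..., n+k}; n may be 0, so its elements are positive. *)
Definition equidivisor_run (n k : nat) : bool :=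
  constant [seq ndiv m | m <- iota n.+1 k].

Definition has_run_below (N k : nat) : bool :=
  [exists n : 'I_N, (n + k < N) && equidivisor_run n k].

(* Any run below N has length k < N, so bounding the index loses nothing. *)
Definition longest_run (N : nat) : nat := \max_(k < N | has_run_below N k) k.

Lemma equidivisor_runP (n k : nat) :
  reflect (forall a b, n < a <= n + k -> n < b <= n + k -> ndiv a = ndiv b)
          (equidivisor_run n k).
Proof.
rewrite /equidivisor_run; case: k => [|k] /=.
  apply: ReflectT => a b /andP[na].
  by rewrite addn0 leqNgt na.
apply: (iffP allP) => [H a b Ha Hb | H x /mapP[m]].
  suff E c : n < c <= n + k.+1 -> ndiv c = ndiv n.+1 by rewrite (E a) // (E b).
  case/andP=> nc ck; case: (ltngtP n.+1 c) => [lt|lt|<- //].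
    apply/eqP/H/map_f; rewrite mem_iota lt /=.
    by rewrite !addSn ltnS -addnS.
  by move: lt; rewrite ltnNge nc.
rewrite mem_iota => /andP[m1 m2] ->; apply/eqP/H; last first.
  by rewrite ltnSn /= addnS ltnS leq_addr.
by rewrite (ltnW m1) /= addnS -addSn -ltnS -addSn.
Qed.

Lemma longest_runP (N : nat) : 1 < N ->
  (exists2 n, n + longest_run N < N & equidivisor_run n (longest_run N)) /\
  (forall n k, n + k < N -> equidivisor_run n k -> k <= longest_run N).
Proof.
move=> N1; split=> [|n k nkN run]; last first.
  have kN : k < N by apply: leq_ltn_trans nkN; apply: leq_addl.
  have nN : n < N by apply: leq_ltn_trans nkN; apply: leq_addr.
  apply: (@leq_bigmax_cond _ (fun i : 'I_N => has_run_below N i) _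
            (Ordinal kN)).
  by apply/existsP; exists (Ordinal nN); rewrite /= nkN.
have run1 : has_run_below N (Ordinal N1).
  by apply/existsP; exists (Ordinal (ltnW N1)); rewrite /= add0n N1.
have [|k rk def_k] :=
  @eq_bigmax_cond _ (fun i : 'I_N => has_run_below N i) (fun i => i : nat).
  by apply/card_gt0P; exists (Ordinal N1).
have -> : longest_run N = k by exact: def_k.
by case/existsP: rk => n /andP[nkN run]; exists n.
Qed.

(* Main.v *)
(** If 2^q <= k, a run of length k contains an integer whose 2-adic valuation is
    exactly q - 1, so q divides the common number of divisors. Conversely, if
    distinct primes q all divide d(n) = prod (a_i + 1), then
    sum (q - 1) <= sum a_i <= log2 n. Taking all primes q in (L/4, L] with
    L = 4^m <= log2 k, of which there are at least L / (8 m) by Chebyshev's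
    argument on the central binomial coefficient, gives
    L^2 <= 32 m log2 N, that is (log k)^2 = O(log N log log N). *)

Require Import Defs.
From mathcomp Require Import all_boot all_order all_algebra.
From mathcomp Require Import all_classical all_reals all_analysis.
From mathcomp Require Import zify ring lra.

Import Order.TTheory GRing.Theory Num.Theory.
Local Open Scope ring_scope.

(** * Prime divisors of the number of divisors *)

Section PrimesAndDivisors.
Local Open Scope nat_scope.

Lemma size_divisors n :
  size (divisors n) = \prod_(p <- primes n) (logn p n).+1.
Proof.
have size_add f divs : size (prime.PrimeDecompAux.add_divisors f divs) = f.2.+1 * size divs.
  case: f => p e /=; elim: e => [|e IHe] /=; first by rewrite mul1n.
  by rewrite size_merge size_cat size_map IHe addnC -mulSn.
rewrite /divisors prime_decompE.
elim: (primes n) => [|p s IHs]; first by rewrite big_nil.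
by rewrite big_cons -IHs; exact: (size_add (p, logn p n)).
Qed.

Lemma dvdn_logS_ndiv p n : p \in primes n -> (logn p n).+1 %| ndiv n.
Proof.
by move=> pn; rewrite /ndiv size_divisors (big_rem p pn) dvdn_mulr.
Qed.

Lemma sum_pred_lt_prod (s : seq nat) : all (leq 1) s ->
  \sum_(q <- s) q.-1 < \prod_(q <- s) q.
Proof.
elim: s => [|q s IHs]; first by rewrite !big_nil.
by rewrite !big_cons /= => /andP[q0 /IHs]; nia.
Qed.

Lemma prod_uniq_primes_dvdn (s : seq nat) m :
  uniq s -> all prime s -> all (dvdn^~ m) s -> \prod_(q <- s) q %| m.
Proof.
elim: s => [|q s IHs]; first by rewrite big_nil dvd1n.
rewrite big_cons /= => /andP[qs us] /andP[pq ps] /andP[qm sm].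
rewrite Gauss_dvd ?qm ?IHs // prime_coprime // Euclid_dvd_prod //.
apply: contra qs; rewrite big_has => /hasP[p p_s].
by rewrite (dvdn_prime2 pq (allP ps p p_s)) => /eqP ->.
Qed.

(** Induction on [r]. The primes of [s] dividing the head factor [(F i).+1] have product at most
    [(F i).+1], so their [q.-1] add up to at most [F i]; by primality the others divide the product
    over the tail. *)
Lemma sum_pred_prime_divisors (I : eqType) (r : seq I) (F : I -> nat)
    (s : seq nat) :
  uniq s -> all prime s -> all (dvdn^~ (\prod_(i <- r) (F i).+1)) s ->
  \sum_(q <- s) q.-1 <= \sum_(i <- r) F i.
Proof.
elim: r s => [|i r IHr] s us ps ds.
  case: s us ps ds => [|q s] _; first by rewrite !big_nil.
  by rewrite /= !big_nil dvdn1 => /andP[pq _] /andP[/eqP q1]; rewrite q1 in pq.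
rewrite big_cons (bigID (dvdn^~ (F i).+1)) /= leq_add //.
  rewrite -ltnS -big_filter.
  apply: leq_trans (sum_pred_lt_prod _ _) _.
    apply/allP => q; rewrite mem_filter => /andP[_ /(allP ps)].
    exact: prime_gt0.
  apply/dvdn_leq/prod_uniq_primes_dvdn => //; first exact: filter_uniq.
    by apply/allP => q; rewrite mem_filter => /andP[_ /(allP ps)].
  by apply/allP => q; rewrite mem_filter => /andP[].
rewrite -big_filter; apply: IHr; first exact: filter_uniq.
  by apply/allP => q; rewrite mem_filter => /andP[_ /(allP ps)].
apply/allP => q; rewrite mem_filter => /andP[ndq qs].
have := allP ds q qs; rewrite big_cons /= Euclid_dvdM ?(allP ps) //.
by rewrite (negPf ndq).
Qed.

(** The exponent is at most the number of prime factors of [n] counted with multiplicity, and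
    replacing each of these factors by 2 does not increase their product. *)
Lemma prime_divisors_ndiv_bound n (s : seq nat) : 0 < n ->
  uniq s -> all prime s -> all (dvdn^~ (ndiv n)) s ->
  2 ^ (\sum_(q <- s) q.-1) <= n.
Proof.
move=> n0 us ps; rewrite /ndiv size_divisors => ds.
apply: (@leq_trans (2 ^ \sum_(p <- primes n) logn p n)).
  by rewrite leq_exp2l // sum_pred_prime_divisors.
rewrite [leqRHS]prod_prime_decomp // prime_decompE big_map /= expn_sum.
rewrite big_seq [leqRHS]big_seq.
apply: leq_prod => p; rewrite mem_primes => /andP[/prime_gt1 p1 _].
by case: (logn p n) => // e; rewrite leq_exp2r.
Qed.

(** * Chebyshev estimates from the central binomial coefficient *)

Lemma leq_mul_central_bin n : 0 < n -> 4 ^ n <= n.*2 * 'C(n.*2, n).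
Proof.
elim: n => // -[|n] IHn _ //.
set m := n.+1 in IHn *.
(* Together these give [m.+1 * 'C(m.*2.+2, m.+1) = 2 * m.*2.+1 * 'C(m.*2, m)], which drives the
   induction. *)
have := mul_bin_diag m.*2.+2 m; have := mul_bin_down m.*2.+1 m.
rewrite /= doubleS => down diag.
have {}down : m.*2.+1 * 'C(m.*2, m) = m.+1 * 'C(m.*2.+1, m).
  by rewrite down; congr (_ * _); lia.
have := IHn isT; rewrite expnS; move: down diag.
by clear; nia.
Qed.

Lemma central_bin_leq n : 'C(n.*2, n) <= 4 ^ n.
Proof.
rewrite -[4]/(2 ^ 2) -expnM mul2n -[2]/(1 + 1) expnDn.
rewrite (bigD1 (inord n)) //= inordK; last by lia.
by rewrite !exp1n !muln1 leq_addr.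
Qed.

(** By Legendre's formula, each [k] contributes [n.*2 %/ p ^ k] minus twice [n %/ p ^ k]: at most 1,
    and 0 once [p ^ k] exceeds [n.*2]. *)
Lemma logn_central_bin p n : prime p -> 0 < n ->
  logn p 'C(n.*2, n) <= trunc_log p n.*2.
Proof.
move=> pp n0; have p1 := prime_gt1 pp.
have le_n : n <= n.*2 by lia.
have C0 : 0 < 'C(n.*2, n) by rewrite bin_gt0.
have := congr1 (logn p) (bin_fact le_n).
rewrite (_ : n.*2 - n = n); last by lia.
rewrite !lognM ?muln_gt0 ?fact_gt0 // !logn_fact //.
set t := trunc_log _ _.
(* The added terms vanish, as [n < k < p ^ k]; all sums then share one range and compare
   termwise. *)
have -> : \sum_(1 <= k < n.+1) n %/ p ^ k = \sum_(1 <= k < n.*2.+1) n %/ p ^ k.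
  rewrite [RHS](@big_cat_nat _ _ _ n.+1) //= [X in _ = _ + X]big_nat_cond.
  rewrite [X in _ = _ + X]big1 ?addn0 // => k /andP[/andP[nk _] _].
  by rewrite divn_small // (ltn_trans nk) // ltn_expl.
have t_le : \sum_(1 <= k < n.*2.+1) (k <= t) <= t.
  rewrite -big_mkcond /= sum1_count -size_filter.
  rewrite -[leqRHS](size_iota 1) uniq_leq_size ?filter_uniq ?iota_uniq //.
  by move=> k; rewrite mem_filter !mem_iota; lia.
suff : \sum_(1 <= k < n.*2.+1) n.*2 %/ p ^ k <=
       \sum_(1 <= k < n.*2.+1) n %/ p ^ k +
       \sum_(1 <= k < n.*2.+1) n %/ p ^ k + \sum_(1 <= k < n.*2.+1) (k <= t).
  by move: t_le; clear; lia.
rewrite -!big_split /=; apply: leq_sum => k _.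
have pk0 : 0 < p ^ k by rewrite expn_gt0 prime_gt0.
have [kt|tk] := leqP k t.
  have := divn_eq n (p ^ k); have := ltn_mod n (p ^ k).
  have := leq_divM n.*2 (p ^ k); rewrite pk0; clear; nia.
rewrite divn_small // (leq_trans (trunc_log_ltn _ p1)) //.
by rewrite leq_exp2l.
Qed.

(** Dyadic induction: a prime in [(2 ^ j, 2 ^ j.+1]] divides [(2 ^ j.+1)!] but not [(2 ^ j)!], hence
    divides the central binomial coefficient, which is at most [4 ^ 2 ^ j]. *)
Lemma prod_uniq_primes_leq j (s : seq nat) :
  uniq s -> all prime s -> all (leq^~ (2 ^ j)) s ->
  \prod_(q <- s) q <= 4 ^ 2 ^ j.
Proof.
elim: j s => [|j IHj] s us ps ls.
  case: s us ps ls => [|q s] _ /=; first by rewrite big_nil.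
  by case/andP=> /prime_gt1 q1 _ /andP[]; rewrite leqNgt q1.
rewrite (bigID (leq^~ (2 ^ j))) /= expnS mul2n -addnn expnD.
apply: leq_mul; rewrite -big_filter.
  apply: IHj; first exact: filter_uniq.
    by apply/allP => q; rewrite mem_filter => /andP[_ /(allP ps)].
  by apply/allP => q; rewrite mem_filter => /andP[].
apply: leq_trans (central_bin_leq _).
apply: dvdn_leq; first by rewrite bin_gt0; lia.
apply: prod_uniq_primes_dvdn; first exact: filter_uniq.
  by apply/allP => q; rewrite mem_filter => /andP[_ /(allP ps)].
apply/allP => q; rewrite mem_filter -ltnNge => /andP[lt_jq qs].
have pq := allP ps q qs; have := allP ls q qs; rewrite expnS mul2n => le_q.
have le2 : 2 ^ j <= (2 ^ j).*2 by lia.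
have := @dvdn_fact q (2 ^ j).*2.
rewrite le_q prime_gt0 // => /(_ isT); rewrite -(bin_fact le2).
rewrite (_ : (2 ^ j).*2 - 2 ^ j = 2 ^ j); last by lia.
rewrite Euclid_dvdM // => /orP[//|].
rewrite Euclid_dvdM // orbb fact_prod Euclid_dvd_prod // big_has.
case/hasP => i; rewrite mem_index_iota => /andP[i0 le_i] /dvdn_leq.
by move/(_ i0); lia.
Qed.

Lemma prod_leq_expn_size (I : eqType) (s : seq I) (F : I -> nat) b :
  {in s, forall i, F i <= b} -> \prod_(i <- s) F i <= b ^ size s.
Proof.
elim: s => [|i s IHs] le_b; first by rewrite big_nil.
rewrite big_cons expnS leq_mul ?le_b ?mem_head // IHs // => j js.
by rewrite le_b // in_cons js orbT.
Qed.

(* With 2n = 4^m, the primes up to 2^m = sqrt(2n) contribute at most (2n)^(2^m)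
   to 'C(2n, n); the larger ones divide it at most once, so those up to n/2
   contribute at most 4^(n/2), and each of the others at most 2n. *)
Lemma many_primes_quarter m : 6 <= m ->
  exists s : seq nat, [/\ uniq s, all prime s,
    {in s, forall q, 4 ^ m < 4 * q /\ q <= 4 ^ m} & 4 ^ m <= 8 * m * size s].
Proof.
move=> m6; pose y := 4 ^ m.-1; pose n := y.*2.
have y_exp : y = 2 ^ (m.-1).*2 by rewrite /y -[4]/(2 ^ 2) -expnM mul2n.
have y0 : 0 < y by rewrite /y expn_gt0.
have n2 : n.*2 = 4 ^ m.
  by rewrite -[m in RHS]prednK ?expnS; [rewrite /n /y; lia | lia].
have n2_exp : n.*2 = 2 ^ m.*2 by rewrite n2 -[4]/(2 ^ 2) -expnM mul2n.
have n0 : 0 < n by rewrite /n; lia.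
pose C := 'C(n.*2, n); have C0 : 0 < C by rewrite bin_gt0 /n; lia.
have pC p : p \in primes C -> prime p by rewrite mem_primes => /andP[].
have le_pow p : p \in primes C -> p ^ logn p C <= n.*2.
  move=> ps; have pp := pC p ps; have p1 := prime_gt1 pp.
  apply: leq_trans (trunc_logP p1 _); last by rewrite double_gt0.
  by rewrite leq_exp2l // logn_central_bin.
have le_p p : p \in primes C -> p <= n.*2.
  move=> ps; apply: leq_trans (le_pow p ps).
  by rewrite -[X in X <= _]expn1 leq_exp2l ?prime_gt1 ?pC // logn_gt0.
have log1 p : p \in primes C -> 2 ^ m < p -> p ^ logn p C <= p.
  move=> ps lt_p; have p1 := prime_gt1 (pC p ps).
  rewrite -[X in _ <= X]expn1 leq_exp2l // -ltnS -(ltn_exp2l _ _ p1).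
  apply: leq_ltn_trans (le_pow p ps) _.
  by rewrite n2_exp -muln2 expnM ltn_exp2r.
pose s := [seq p <- [seq p <- primes C | ~~ (p <= 2 ^ m)] | ~~ (p <= y)].
have sP p : p \in s -> p \in primes C /\ y < p.
  by rewrite !mem_filter -!ltnNge => /and3P[].
exists s; split; [by rewrite !filter_uniq // primes_uniq | | |].
- by apply/allP => p /sP[/pC].
- by move=> p /sP[/le_p le_pn lt_yp]; rewrite -n2 /n; split=> //; lia.
have C_le : C <= n.*2 ^ 2 ^ m * (4 ^ y * n.*2 ^ size s).
  rewrite [leqLHS]prod_prime_decomp // prime_decompE big_map /=.
  rewrite (bigID (leq^~ (2 ^ m))) /= -big_filter.
  rewrite -[X in _ * X <= _]big_filter.
  apply: leq_mul.
    apply: leq_trans (prod_leq_expn_size _ _ _ n.*2 _) _.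
      by move=> p; rewrite mem_filter => /andP[_ /le_pow].
    rewrite leq_pexp2l ?double_gt0 // -[leqRHS](size_iota 1).
    rewrite uniq_leq_size ?filter_uniq ?primes_uniq // => p.
    rewrite mem_filter mem_iota add1n ltnS => /andP[-> /pC].
    by rewrite andbT; apply: prime_gt0.
  rewrite (bigID (leq^~ y)) /= -big_filter -[X in _ * X <= _]big_filter.
  apply: leq_mul; last first.
    by apply: prod_leq_expn_size => p /sP[/le_pow].
  apply: (@leq_trans (\prod_(p <- [seq p <- [seq p <- primes C |
            ~~ (p <= 2 ^ m)] | p <= y]) p)).
    rewrite big_seq [leqRHS]big_seq; apply: leq_prod => p.
    by rewrite !mem_filter -ltnNge => /and3P[_ lt_p /log1]; apply.
  rewrite y_exp; apply: prod_uniq_primes_leq.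
  - by rewrite !filter_uniq // primes_uniq.
  - by apply/allP => p; rewrite !mem_filter => /and3P[_ _ /pC].
  by apply/allP => p; rewrite mem_filter => /andP[].
have : 2 ^ n.*2 <= 2 ^ (m.*2 + (m.*2 * 2 ^ m + (n + m.*2 * size s))).
  have -> : 2 ^ (m.*2 + (m.*2 * 2 ^ m + (n + m.*2 * size s))) =
            n.*2 * (n.*2 ^ 2 ^ m * (4 ^ y * n.*2 ^ size s)).
    have y4 : 2 ^ n = 4 ^ y by rewrite /n -mul2n expnM.
    by rewrite !expnD !expnM -n2_exp y4.
  apply: (@leq_trans (n.*2 * C)); last by rewrite leq_mul2l C_le orbT.
  have -> : 2 ^ n.*2 = 4 ^ n by rewrite -mul2n expnM.
  exact: leq_mul_central_bin.
rewrite leq_exp2l //.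
(* This is where [6 <= m] is needed. Of the exponent [n.*2 = 4 ^ m], the term [n] takes half and
   [m.*2 * (1 + 2 ^ m)] at most a quarter, so [m.*2 * size s] covers the remaining quarter. *)
have m_small : 8 * m * (1 + 2 ^ m) <= 2 ^ m * 2 ^ m.
  have -> : m = m - 6 + 6 by lia.
  elim: (m - 6) => // j; rewrite !addSn !expnS.
  have : 2 ^ 6 <= 2 ^ (j + 6) by rewrite leq_exp2l // leq_addl.
  rewrite -[2 ^ 6]/64; move: (j + 6) (2 ^ _); clear=> i P P64 le_P.
  have P2 : 64 * P <= P * P by rewrite leq_mul2r P64 orbT.
  by nia.
have : n.*2 = 2 ^ m * 2 ^ m by rewrite n2_exp -addnn expnD.
by rewrite -n2; move: m_small; move: (2 ^ m) (size s); clear; nia.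
Qed.

(** * Divisibility forced by a long run *)

Lemma dvdn_ndiv_run n k q a : 1 < q -> 2 ^ q <= k -> equidivisor_run n k ->
  n < a <= n + k -> q %| ndiv a.
Proof.
move=> q1 le_k /equidivisor_runP run a_run.
pose Q := 2 ^ q.-1.
have Q0 : 0 < Q by rewrite expn_gt0.
have Q2 : 2 ^ q = Q.*2 by rewrite -[q]prednK ?expnS ?mul2n //; lia.
(* The only integer of (n, n + 2 Q] congruent to Q modulo 2 Q. *)
pose b := Q * ((n + Q) %/ Q.*2).*2.+1.
have b_run : n < b <= n + k.
  have := divn_eq (n + Q) Q.*2; have := ltn_mod (n + Q) Q.*2.
  rewrite double_gt0 Q0 /b; move: le_k; rewrite Q2; clear; nia.
have b_log : logn 2 b = q.-1.
  rewrite lognM // pfactorK // logn_coprime ?addn0 //.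
  by rewrite coprime2n /= odd_double.
rewrite (run a b) // -[q]prednK -?b_log; last by lia.
by apply: dvdn_logS_ndiv; rewrite -logn_gt0 b_log; lia.
Qed.

Lemma run_length_bound n k m : 6 <= m -> 2 ^ 4 ^ m <= k ->
  equidivisor_run n k -> 16 ^ m <= 32 * m * trunc_log 2 n.+1.
Proof.
move=> m6 le_k run; have [s [us ps s_bd s_size]] := many_primes_quarter m m6.
have k0 : 0 < k by apply: leq_trans le_k; rewrite expn_gt0.
have := prime_divisors_ndiv_bound n.+1 s isT us ps.
have -> : all (dvdn^~ (ndiv n.+1)) s.
  apply/allP => q qs; have [_ q_le] := s_bd q qs.
  apply: (@dvdn_ndiv_run n k) => //; first exact/prime_gt1/(allP ps).
    by apply: leq_trans le_k; rewrite leq_exp2l.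
  by rewrite ltnSn -[n.+1]addn1 leq_add2l.
move=> /(_ isT) /(trunc_log_max (isT : 1 < 2)).
(* Each [q] in [s] exceeds [4 ^ m.-1], so [q.-1] is at least a quarter of [4 ^ m]. *)
have : 4 ^ m * size s <= 4 * \sum_(q <- s) q.-1.
  rewrite big_distrr /= -sum1_size big_distrr /= big_seq [leqRHS]big_seq.
  apply: leq_sum => q /s_bd[lt_q _].
  have m0 : m = m.-1.+1 by lia.
  by move: lt_q; rewrite m0 expnS; lia.
rewrite -[16]/(4 * 4) expnMn; move: s_size.
move: (4 ^ m) (size s) (\sum_(q <- s) _) (trunc_log _ _) => A c S T.
move=> h1 h2 h3.
apply: (@leq_trans (8 * m * (A * c))); first by nia.
have -> : 32 * m * T = 8 * m * (4 * T) by lia.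
by rewrite leq_mul2l (leq_trans h2) ?orbT // leq_mul2l h3 orbT.
Qed.

End PrimesAndDivisors.

(** * Comparison of natural and binary logarithms *)

Section LogarithmBounds.
Context {R : realType}.
Implicit Type e n : nat.

Lemma ln_expn2 e : ln (2 ^ e)%N%:R = e%:R * ln 2 :> R.
Proof. by rewrite natrX lnXn // mulr_natl. Qed.

Lemma ln2_ge_half : 2^-1 <= ln 2 :> R.
Proof.
rewrite -lerN2 -lnV ?posrE //.
rewrite [X in ln X](_ : _ = 1 - 2^-1); last by field.
by apply: le_ln1Dx; lra.
Qed.

Lemma half_le_ln e n : (2 ^ e <= n)%N -> e%:R / 2 <= ln n%:R :> R.
Proof.
move=> le_n; apply: (@le_trans _ _ (ln (2 ^ e)%N%:R)).
  by rewrite ln_expn2 ler_wpM2l // ln2_ge_half.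
have n0 : (0 < n)%N by apply: leq_trans le_n; rewrite expn_gt0.
by rewrite ler_ln ?posrE ?ltr0n ?ler_nat ?expn_gt0.
Qed.

Lemma ln_le_exponent e n : (0 < n)%N -> (n <= 2 ^ e)%N -> ln n%:R <= e%:R :> R.
Proof.
move=> n0 le_n; apply: (@le_trans _ _ (ln (2 ^ e)%N%:R)).
  by rewrite ler_ln ?posrE ?ltr0n ?ler_nat ?expn_gt0.
rewrite ln_expn2 ler_piMr //; have := @le_ln1Dx R 1.
by rewrite (_ : 1 + 1 = 2) //; apply; lra.
Qed.

End LogarithmBounds.

Theorem theorem1 (R : realType) :
  exists C : R, 0 < C /\
  exists N0 : nat, forall N : nat, (2 <= N)%N -> (N0 <= N)%N ->
    ln (longest_run N)%:R <= C * Num.sqrt (ln N%:R * ln (ln N%:R)).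
Proof.
(* The constant is dictated by the case [m < 6], where [ln l <= 4 ^ m.+1 <= 4 ^ 6]; the other case
   only needs its square to be at least 2048. *)
exists (4 ^+ 6); split; first by rewrite exprn_gt0.
(* This threshold ensures [ln N >= 4] and [ln (ln N) >= 1]. *)
exists (2 ^ 8)%N => N N2 leN.
have [[n lt_nl run] max_run] := longest_runP N2.
set l := longest_run N in lt_nl run max_run *.
(* The singleton run consisting of 1 lies below [N]. *)
have l0 : (0 < l)%N by apply: (max_run 0%N).
set X : R := ln N%:R.
have X4 : 4 <= X by have := half_le_ln _ _ leN : _ <= X; lra.
have Y1 : 1 <= ln X.
  have : ln 4 <= ln X by rewrite ler_ln ?posrE //; lra.
  by have := @half_le_ln R 2 4 isT; lra.
have XY1 : 1 <= X * ln X by nra.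
(* [4 ^ m] is the largest power of 4 not exceeding the binary logarithm of [l], so rounding costs
   only a constant factor. *)
set t := trunc_log 2 l; set m := trunc_log 4 t.
have ln_l : ln l%:R <= (4 ^ m.+1)%N%:R :> R.
  apply: ln_le_exponent => //.
  apply: leq_trans (ltnW (trunc_log_ltn l (isT : (1 < 2)%N))) _.
  by rewrite leq_exp2l // trunc_log_ltn.
apply: le_trans ln_l _.
have [m6|m6] := ltnP m 6.
  apply: (@le_trans _ _ (4 ^+ 6)).
    by rewrite -natrX ler_nat leq_exp2l.
  by rewrite ler_peMr ?exprn_ge0 // -[leLHS]sqrtr1 ler_sqrt // (le_trans _ XY1).
(* The default [trunc_log 4 0 = 0] would contradict [6 <= m]. *)
have t0 : (0 < t)%N by move: m6; rewrite /m; case: (t) => //; rewrite trunc_log0.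
have le_l : (2 ^ 4 ^ m <= l)%N.
  apply: leq_trans (trunc_logP (isT : (1 < 2)%N) l0).
  by rewrite leq_exp2l // trunc_logP.
have := run_length_bound n l m m6 le_l run; set T := trunc_log 2 n.+1 => le_T.
have TX : T%:R / 2 <= X.
  apply: half_le_ln; apply: leq_trans (trunc_logP _ _) _ => //.
  by rewrite (leq_trans _ (ltnW lt_nl)) // -addn1 leq_add2l.
have m_4 : (32 * m <= 4 ^ m)%N.
  have -> : m = (m - 6 + 6)%N by lia.
  by elim: (m - 6)%N => // j; rewrite !addSn expnS; lia.
have A_T : (4 ^ m <= T)%N.
  move: le_T; rewrite -[16%N]/(4 * 4)%N expnMn => le_T.
  have A0 : (0 < 4 ^ m)%N by rewrite expn_gt0.
  rewrite -(leq_pmul2l A0); apply: leq_trans le_T _.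
  by rewrite leq_mul2r m_4 orbT.
(* Since [2 * 2 ^ m <= 4 ^ m <= T <= 2 * X], one gets [2 ^ m <= X]; this turns the factor [m] into
   the double logarithm. *)
have m_Y : m%:R / 2 <= ln X.
  apply: le_trans (half_le_ln _ _ (leqnn (2 ^ m))) _.
  have pow2 : (2 * 2 ^ m <= 4 ^ m)%N.
    rewrite -[4%N]/(2 * 2)%N expnMn leq_mul2r; apply/orP; right.
    by rewrite -[X in (X <= _)%N]expn1 leq_exp2l //; lia.
  rewrite ler_ln ?posrE ?ltr0n ?expn_gt0 //; last by lra.
  have : (2 * 2 ^ m)%N%:R <= T%:R :> R by rewrite ler_nat (leq_trans pow2).
  by rewrite natrM; lra.
rewrite -ler_sqr ?nnegrE ?ler0n ?mulr_ge0 ?exprn_ge0 ?sqrtr_ge0 //.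
rewrite exprMn sqr_sqrtr; last by lra.
have -> : (4 ^ m.+1)%N%:R ^+ 2 = 16 * (16 ^ m)%N%:R :> R.
  by rewrite -natrX -expnM mulnC expnM expnS natrM.
apply: (@le_trans _ _ (16 * (32 * m * T)%N%:R)).
  by rewrite ler_wpM2l // ler_nat.
rewrite !natrM.
have : (m%:R / 2) * (T%:R / 2) <= ln X * X by rewrite ler_pM // divr_ge0.
lra.
Qed.
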